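(* Let $s>1$ and $N\ge2$ be integers. Given a regular Hadamard matrix of order $s$ and an orthogonal array of size $s^2\times N$: (1) there exists a set of $N-1$ regular unbiased Hadamard matrices of order $s^2$; (2) there exists a non-degenerate $LSSD(v,k,\lambda;w)$ with $v=s^2$ and $w=N$, for some $k,\lambda$.
   Context: A real Hadamard matrix of order $n$ is an $n\times n$ matrix $H$ with entries $\pm1$ and $HH^T=nI$. It is regular if $HJ=cJ$ for some constant $c$, where $J$ is the all-ones matrix. Two Hadamard matrices $H_1,H_2$ of order $n$ are unbiased if $\frac{1}{\sqrt n}H_1H_2^T$ is a Hadamard matrix; a set of Hadamard matrices is unbiased if every two distinct members are unbiased. An orthogonal array of size $s^2\times N$ is an $s^2\times N$ array with entries from $\{1,\dots,s\}$ such that in any two distinct columns each ordered pair of symbols occurs in exactly one row. A symmetric $(v,k,\lambda)$-design consists of a set of $v$ points and a collection of $v$ blocks such that every block contains $k$ points, every point lies in $k$ blocks, every pair of distinct points lies in exactly $\lambda$ common blocks, and every pair of distinct blocks meets in exactly $\lambda$ points. Its incidence graph is the bipartite graph on points and blocks with a point adjacent to a block iff the point is in the block. A linked system of symmetric designs $LSSD(v,k,\lambda;w)$, $w\ge 2$, is a graph $\Gamma$ on $wv$ vertices whose vertex set is partitioned into $w$ sets (''fibers'') $X_1,\dots,X_w$ of size $v$ such that: (i) no edge has both ends in the same fiber; (ii) for all $i\ne j$, the subgraph of $\Gamma$ induced between $X_i$ and $X_j$ is the incidence graph of some symmetric $(v,k,\lambda)$-design; (iii) there are constants $\mu,\nu$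 such that for all distinct $h,i,j$ and all $a\in X_i$, $b\in X_j$, the number of common neighbours of $a$ and $b$ lying in $X_h$ is $\mu$ if $a\sim b$ and $\nu$ if $a\not\sim b$. It is non-degenerate if $1<k<v-1$. *)

(* Defs.v *)
From mathcomp Require Import all_boot all_order all_algebra.

Set Implicit Arguments.
Unset Strict Implicit.
Unset Printing Implicit Defensive.

Import GRing.Theory Num.Theory.

Local Open Scope ring_scope.

(* Real matrices are taken over an arbitrary real closed field [R], so that
   square roots exist; the field of real numbers is one instance. *)

Definition hadamard (R : rcfType) (n : nat) (H : 'M[R]_n) : Prop :=
  (forall i j, H i j = 1 \/ H i j = -1) /\ H *m H^T = (n%:R)%:M.

Definition regular (R : rcfType) (n : nat) (H : 'M[R]_n) : Prop :=
  exists c : R, H *m (const_mx 1 : 'M[R]_n) = c *: (const_mx 1 : 'M[R]_n).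

Definition unbiased (R : rcfType) (n : nat) (H1 H2 : 'M[R]_n) : Prop :=
  hadamard ((Num.sqrt (n%:R : R))^-1 *: (H1 *m H2^T)).

(* A finite set of matrices is given by a duplicate-free sequence. *)
Definition regular_unbiased_hadamard_set (R : rcfType) (n : nat)
    (S : seq 'M[R]_n) : Prop :=
  [/\ uniq S,
      {in S, forall H, hadamard H /\ regular H} &
      {in S &, forall H1 H2, H1 != H2 -> unbiased H1 H2}].

(* The symbols {1, ..., s} are represented by ['I_s]. *)
Definition orthogonal_array (s N : nat) (A : 'M['I_s]_(s ^ 2, N)) : Prop :=
  forall j1 j2 : 'I_N, j1 != j2 -> forall a b : 'I_s,
    #|[set r | (A r j1 == a) && (A r j2 == b)]| = 1%N.

Record symmetric_design (P B : finType) (inc : P -> B -> bool)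
    (v k lam : nat) : Prop := SymmetricDesign {
  design_points : #|P| = v;
  design_blocks : #|B| = v;
  design_block_size : forall b, #|[set p | inc p b]| = k;
  design_point_degree : forall p, #|[set b | inc p b]| = k;
  design_two_points : forall p q, p != q ->
    #|[set b | inc p b && inc q b]| = lam;
  design_two_blocks : forall b c, b != c ->
    #|[set p | inc p b && inc p c]| = lam
}.

Definition incidence_graph (P B : finType) (inc : P -> B -> bool) :
    rel (P + B) :=
  fun x y => match x, y with
             | inl p, inr b => inc p b
             | inr b, inl p => inc p b
             | _, _ => false
             end.

(* The vertex map [f] identifies the points with [Y] and the blocks with [Z];
   this is used for disjoint [Y] and [Z] without internal edges. *)
Definition is_design_graph (V : finType) (e : rel V) (Y Z : {set V})
    (v k lam : nat) : Prop :=
  exists (P B : finType) (inc : P -> B -> bool) (f : P + B -> V),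
    [/\ symmetric_design inc v k lam,
        injective f,
        [set f (inl p) | p : P] = Y,
        [set f (inr b) | b : B] = Z &
        forall x y, e (f x) (f y) = incidence_graph inc x y].

Record LSSD (V : finType) (e : rel V) (X : {set {set V}})
    (v k lam w : nat) : Prop := MkLSSD {
  LSSD_w : (2 <= w)%N;
  LSSD_order : #|V| = (w * v)%N;
  LSSD_sym : symmetric e;
  LSSD_irr : irreflexive e;
  LSSD_partition : partition X [set: V];
  LSSD_fibers : #|X| = w;
  LSSD_fiber_size : forall Y, Y \in X -> #|Y| = v;
  LSSD_no_edge : forall Y, Y \in X -> {in Y &, forall a b, ~~ e a b};
  LSSD_design : forall Y Z, Y \in X -> Z \in X -> Y != Z ->
    is_design_graph e Y Z v k lam;
  LSSD_linked : exists mu nu : nat,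
    forall Xh Xi Xj, Xh \in X -> Xi \in X -> Xj \in X ->
      Xh != Xi -> Xh != Xj -> Xi != Xj ->
    forall a b, a \in Xi -> b \in Xj ->
      #|[set c in Xh | e a c && e b c]| = if e a b then mu else nu
}.

Definition non_degenerate (v k : nat) : Prop := (1 < k < v - 1)%N.

(* Main.v *)
Require Import Defs.
From mathcomp Require Import all_boot all_order all_algebra.
From mathcomp Require Import zify ring lra.

(** Each column [j] of the orthogonal array splits the [s ^ 2] rows into [s]
    classes of size [s].  Placing a copy of [H] on every class produces a
    matrix [W_j] of order [s ^ 2] with [W_j W_j^T = s I].  For [i <> j] a class
    of column [i] and a class of column [j] share exactly one row, so every
    entry of [M_ij = W_i W_j^T] is a product of two entries of [H], that is, a
    sign.  Since [W_j^T W_j = s I] too, [M_ij M_jk = s M_ik] for all [i], [j],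
    [k], and in particular [M_ij] is Hadamard.  Regularity of [H] gives all the
    [W_j] one common row sum and one common column sum, whose product is [s];
    hence every row sum of [M_ij] is [s].

    Both conclusions follow from these identities alone, which are recorded in
    [linked_hadamard].  For a fixed column [o] the matrices [M_io] with
    [i <> o] are regular and Hadamard, and [M_io M_ko^T = s M_ik] says that they
    are unbiased ([linked_hadamard_unbiased]).  Joining [(i, x)] to [(j, y)] when
    [M_ij x y = 1] gives the linked system: the number of positions at which two
    sign vectors both equal [1] is a linear function of their sums and their
    inner product, and here the inner product of row [a] of [M_ih] and row [b]
    of [M_jh] is [s M_ij a b], which depends only on adjacency
    ([linked_hadamard_LSSD]).

    The block size is [(s ^ 2 + s) / 2], which is non-degenerate once [s > 2];
    order [2] is impossible because two rows with the same nonzero sum would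
    be equal, and two rows with sum zero would be proportional. *)

Set Implicit Arguments.
Unset Strict Implicit.
Unset Printing Implicit Defensive.

Import Order.TTheory GRing.Theory Num.Theory.

Local Open Scope ring_scope.

(** * Regular Hadamard matrices *)

Lemma mul_tr_scalar (F : fieldType) (n : nat) (a : F) (B : 'M[F]_n) :
  a != 0 -> B *m B^T = a%:M -> B^T *m B = a%:M.
Proof.
move=> a_neq0 BBT; have : B *m (a^-1 *: B^T) = 1%:M.
  by rewrite -scalemxAr BBT scale_scalar_mx mulVf.
move/mulmx1C; rewrite -scalemxAl => /(congr1 (fun C => a *: C)).
by rewrite scalerA divff // scale1r scale_scalar_mx mulr1.
Qed.

(** The column sums are constant too: weighting the rows of [H] by their common
    sum [c] and adding them up computes the column sums of [H^T H = s I], so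
    that [c] times any column sum of [H] is [s]. *)
Lemma regular_hadamard_sums (R : rcfType) (s : nat) (H : 'M[R]_s) :
  (0 < s)%N -> hadamard H -> regular H ->
  exists c d : R, [/\ c * d = s%:R, forall i, \sum_j H i j = c
                    & forall j, \sum_i H i j = d].
Proof.
move=> s_gt0 [_ HHT] [c Hc].
have s_neq0 : s%:R != 0 :> R by rewrite pnatr_eq0 -lt0n.
have rowH i : \sum_j H i j = c.
  move/matrixP/(_ i i): (Hc); rewrite !mxE mulr1 => <-.
  by apply: eq_bigr => j _; rewrite mxE mulr1.
have HTH := mul_tr_scalar s_neq0 HHT.
have colH j : c * (\sum_i H i j) = s%:R.
  transitivity (\sum_i \sum_k H i k * H i j).
    by rewrite mulr_sumr; apply: eq_bigr => i _; rewrite -mulr_suml rowH.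
  rewrite exchange_big /=.
  under eq_bigr => k _.
    have -> : \sum_i H i k * H i j = (H^T *m H) k j.
      by rewrite !mxE; apply: eq_bigr => i _; rewrite !mxE.
    rewrite HTH !mxE; over.
  rewrite (bigD1 j) //= eqxx big1 ?addr0 // => k /negPf ->.
  by rewrite mulr0n.
have c_neq0 : c != 0.
  apply: contra_neq s_neq0 => c0.
  by rewrite -(colH (Ordinal s_gt0)) c0 mul0r.
exists c, (s%:R / c); split=> //; first by rewrite mulrCA divff // mulr1.
by move=> j; rewrite -(colH j) mulrAC divff // mul1r.
Qed.

Lemma regular_hadamard_order_neq2 (R : rcfType) (s : nat) (H : 'M[R]_s) :
  hadamard H -> regular H -> s != 2.
Proof.
move=> hH hreg; apply/eqP=> s2; subst s.
have [//|c [d [_ rowH _]]] := regular_hadamard_sums _ hH hreg.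
case: hH => pm /matrixP/(_ ord0 (lift ord0 ord0)).
move: (rowH ord0) (rowH (lift ord0 ord0)).
rewrite !mxE !big_ord_recl !big_ord0 !mxE /=.
have:= pm ord0 ord0; have:= pm ord0 (lift ord0 ord0).
have:= pm (lift ord0 ord0) ord0; have:= pm (lift ord0 ord0) (lift ord0 ord0).
by do 4![case=> ->]; lra.
Qed.

(** * Sign matrices on the rows of an orthogonal array *)

(** A pair of distinct columns identifies the rows of the array with the pairs
    of symbols. *)
Lemma orthogonal_array_sum (R : rcfType) (s N : nat)
    (A : 'M['I_s]_(s ^ 2, N)) (p q : 'I_N) (F : 'I_s -> 'I_s -> R) :
  orthogonal_array A -> p != q ->
  \sum_r F (A r p) (A r q) = \sum_a \sum_b F a b.
Proof.
move=> hA pq; rewrite pair_big /=.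
rewrite (partition_big (fun r => (A r p, A r q)) predT) //=.
apply: eq_bigr => -[a b] _ /=.
under eq_bigr => r /eqP[-> ->] do [].
rewrite sumr_const (_ : #|_| = 1%N) // -[RHS](hA _ _ pq a b) cardsE.
by apply: eq_card => r; rewrite unfold_in.
Qed.

Record linked_hadamard (R : rcfType) (s N : nat)
    (M : 'I_N -> 'I_N -> 'M[R]_(s ^ 2)) : Prop := LinkedHadamard {
  lh_sign : forall i j x y, i != j -> M i j x y = 1 \/ M i j x y = -1;
  lh_tr : forall i j, (M i j)^T = M j i;
  lh_diag : forall i, M i i = s%:R%:M;
  lh_mul : forall i j k, M i j *m M j k = s%:R *: M i k;
  lh_row : forall i j x, \sum_y M i j x y = s%:R
}.

(** The direct sum of copies of [H] over the classes of column [j].  Rows and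
    columns are both indexed by the rows of the array, and the entries of
    another column [j'] number the elements inside a class of [j]. *)
Definition class_sum (R : rcfType) (s N : nat) (H : 'M[R]_s)
    (A : 'M['I_s]_(s ^ 2, N)) (j j' : 'I_N) : 'M[R]_(s ^ 2) :=
  \matrix_(t, r) ((A t j == A r j)%:R * H (A t j') (A r j')).

Lemma sum_delta (R : pzRingType) (T : finType) (a : T) (F : T -> R) :
  \sum_b (a == b)%:R * F b = F a.
Proof.
rewrite (bigD1 a) //= eqxx mul1r big1 ?addr0 // => b ba.
by rewrite eq_sym (negPf ba) mul0r.
Qed.

Section ClassSum.

Variables (R : rcfType) (s N : nat) (H : 'M[R]_s) (A : 'M['I_s]_(s ^ 2, N)).
Hypothesis hA : orthogonal_array A.

Lemma class_sum_row (c : R) (j j' : 'I_N) t :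
  j != j' -> (forall a, \sum_b H a b = c) ->
  \sum_r class_sum H A j j' t r = c.
Proof.
move=> jj' rowH; under eq_bigr => r _ do rewrite mxE.
rewrite (orthogonal_array_sum
  (fun a b => (A t j == a)%:R * H (A t j') b) hA jj').
under eq_bigr => a _ do rewrite -mulr_sumr rowH.
exact: (sum_delta (A t j) (fun=> c)).
Qed.

Lemma class_sum_col (d : R) (j j' : 'I_N) r :
  j != j' -> (forall b, \sum_a H a b = d) ->
  \sum_t class_sum H A j j' t r = d.
Proof.
move=> jj' colH; under eq_bigr => t _ do rewrite mxE eq_sym.
rewrite (orthogonal_array_sum
  (fun a b => (A r j == a)%:R * H b (A r j')) hA jj').
under eq_bigr => a _ do rewrite -mulr_sumr colH.
exact: (sum_delta (A r j) (fun=> d)).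
Qed.

Lemma class_sum_mul_tr (j j' : 'I_N) :
  j != j' -> H *m H^T = s%:R%:M ->
  class_sum H A j j' *m (class_sum H A j j')^T = s%:R%:M.
Proof.
move=> jj' HHT; apply/matrixP=> x y; rewrite !mxE.
under eq_bigr => r _ do rewrite !mxE.
rewrite (orthogonal_array_sum (fun a b => (A x j == a)%:R * H (A x j') b *
  ((A y j == a)%:R * H (A y j') b)) hA jj').
under eq_bigr => a _.
  under eq_bigr => b _ do rewrite mulrACA -mulrA.
  rewrite -!mulr_sumr; over.
rewrite sum_delta.
have -> : \sum_b H (A x j') b * H (A y j') b = (H *m H^T) (A x j') (A y j').
  by rewrite mxE; apply: eq_bigr => b _; rewrite mxE.
have xyE : (x == y) = (A x j == A y j) && (A x j' == A y j').
  apply/eqP/andP=> [->//|[/eqP xy /eqP xy']].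
  have /eqP/cards1P[r Er] := hA jj' (A x j) (A x j').
  have : x \in [set r] by rewrite -Er inE !eqxx.
  have : y \in [set r] by rewrite -Er inE xy xy' !eqxx.
  by rewrite !inE => /eqP -> /eqP ->.
by rewrite HHT mxE xyE (eq_sym (A y j)) -!(mulr_natl s%:R) mulrA -natrM mulnb.
Qed.

(** Only one row of the array has both [A x i] in column [i] and [A y j] in
    column [j], and only that row contributes to the inner product. *)
Lemma class_sum_mul_sign (i i' j j' : 'I_N) x y :
  i != j -> (forall a b, H a b = 1 \/ H a b = -1) ->
  let M := class_sum H A i i' *m (class_sum H A j j')^T in
  M x y = 1 \/ M x y = -1.
Proof.
move=> ij pm /=; rewrite mxE.
have /eqP/cards1P[r Er] := hA ij (A x i) (A y j).
have /andP[/eqP xr /eqP yr] : (A r i == A x i) && (A r j == A y j).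
  by have := set11 r; rewrite -Er inE.
rewrite (bigD1 r) //= big1 => [|q qr].
  rewrite !mxE xr yr !eqxx !mul1r addr0.
  by case: (pm (A x i') (A r i')) => ->; case: (pm (A y j') (A r j')) => ->;
    rewrite ?mulrNN ?mul1r ?mulr1; auto.
rewrite !mxE mulrACA -natrM mulnb.
suff -> : (A x i == A q i) && (A y j == A q j) = false by rewrite mul0r.
rewrite (eq_sym (A x i)) (eq_sym (A y j)).
by move/setP/(_ q): Er; rewrite !inE => ->; rewrite (negPf qr).
Qed.

End ClassSum.

Lemma linked_hadamard_exists (R : rcfType) (s N : nat) (H : 'M[R]_s)
    (A : 'M['I_s]_(s ^ 2, N)) :
  (0 < s)%N -> (2 <= N)%N -> hadamard H -> regular H -> orthogonal_array A ->
  exists M : 'I_N -> 'I_N -> 'M[R]_(s ^ 2), linked_hadamard M.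
Proof.
move=> s_gt0 N_ge2 hH hreg hA.
have [c [d [cd rowH colH]]] := regular_hadamard_sums s_gt0 hH hreg.
have [pm HHT] := hH.
have s_neq0 : s%:R != 0 :> R by rewrite pnatr_eq0 -lt0n.
pose o0 : 'I_N := Ordinal (ltnW N_ge2); pose o1 : 'I_N := Ordinal N_ge2.
pose other j := if j == o0 then o1 else o0.
have otherP j : j != other j by rewrite /other; case: (eqVneq j o0) => [->|].
pose W j := class_sum H A j (other j).
have WWT j : W j *m (W j)^T = s%:R%:M by apply: class_sum_mul_tr.
have WTW j := mul_tr_scalar s_neq0 (WWT j).
exists (fun i j => W i *m (W j)^T); split=> //.
- by move=> i j x y ij; apply: class_sum_mul_sign.
- by move=> i j; rewrite trmx_mul trmxK.
- move=> i j k; rewrite mulmxA -(mulmxA (W i)) WTW.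
  by rewrite mul_mx_scalar scalemxAl.
- move=> i j x; under eq_bigr => y _ do rewrite mxE.
  rewrite exchange_big /=.
  under eq_bigr => r _.
    rewrite -mulr_sumr.
    under eq_bigr => y _ do rewrite mxE.
    rewrite (class_sum_col hA _ (otherP j) colH); over.
  by rewrite -mulr_suml (class_sum_row hA _ (otherP i) rowH).
Qed.

(** * Unbiased Hadamard matrices *)

Lemma linked_hadamard_hadamard (R : rcfType) (s N : nat)
    (M : 'I_N -> 'I_N -> 'M[R]_(s ^ 2)) (i j : 'I_N) :
  linked_hadamard M -> i != j -> hadamard (M i j).
Proof.
move=> hM ij; split=> [x y|]; first exact: (lh_sign hM).
by rewrite (lh_tr hM) (lh_mul hM) (lh_diag hM) scale_scalar_mx -natrM mulnn.
Qed.

Lemma linked_hadamard_unbiased (R : rcfType) (s N : nat)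
    (M : 'I_N -> 'I_N -> 'M[R]_(s ^ 2)) :
  (1 < s)%N -> (0 < N)%N -> linked_hadamard M ->
  exists S : seq 'M[R]_(s ^ 2),
    size S = (N - 1)%N /\ regular_unbiased_hadamard_set S.
Proof.
move=> s_gt1 N_gt0 hM; pose o : 'I_N := Ordinal N_gt0.
have s_neq0 : s%:R != 0 :> R by rewrite pnatr_eq0 -lt0n ltnW.
have MMT i k : M i o *m (M k o)^T = s%:R *: M i k.
  by rewrite (lh_tr hM) (lh_mul hM).
have Minj : injective (M^~ o).
  move=> i k /= eqM; apply/eqP/idPn=> ik.
  have x : 'I_(s ^ 2) by apply: (@Ordinal _ 0); rewrite expn_gt0 ltnW.
  have : s%:R *: M i i = s%:R *: M i k by rewrite -!MMT eqM.
  move/(scalerI s_neq0)/matrixP/(_ x x).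
  have s1 : 1 < s%:R :> R by rewrite ltr1n.
  rewrite (lh_diag hM) mxE eqxx mulr1n.
  by case: (lh_sign hM x x ik) => -> eq_s; clear -s1 eq_s; lra.
exists [seq M i o | i <- enum [set~ o]]; split.
  by rewrite size_map -cardE cardsC1 card_ord subn1.
split.
- by rewrite map_inj_uniq ?enum_uniq.
- move=> B /mapP[i]; rewrite mem_enum !inE => io ->{B}.
  split; first exact: linked_hadamard_hadamard.
  exists s%:R; apply/matrixP=> x y; rewrite !mxE mulr1 -(lh_row hM i o x).
  by apply: eq_bigr => z _; rewrite mxE mulr1.
- move=> B C /mapP[i _ ->] /mapP[k _ ->] neqM.
  have ik : i != k by apply: contra_neq neqM => ->.
  rewrite /unbiased MMT natrX sqrtr_sqr normr_nat scalerA mulVf // scale1r.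
  exact: linked_hadamard_hadamard.
Qed.

(** * Linked systems of symmetric designs *)

(** For a sign [x] the indicator of [x = 1] is [(1 + x) / 2]. *)
Lemma card_sign (R : rcfType) (T : finType) (f : T -> R) :
  (forall t, f t = 1 \/ f t = -1) ->
  2 * #|[set t | f t == 1]|%:R = #|T|%:R + \sum_t f t.
Proof.
move=> pm; rewrite -sum1_card natr_sum mulr_sumr -[#|T|]sum1_card natr_sum.
rewrite -big_split big_mkcond /=; apply: eq_bigr => t _; rewrite inE.
case: (pm t) => ->; rewrite ?eqxx; first by lra.
have -> : ((-1 : R) == 1) = false by apply/eqP; lra.
by lra.
Qed.

Lemma card_sign2 (R : rcfType) (T : finType) (f g : T -> R) :
  (forall t, f t = 1 \/ f t = -1) -> (forall t, g t = 1 \/ g t = -1) ->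
  4 * #|[set t | (f t == 1) && (g t == 1)]|%:R =
  #|T|%:R + \sum_t f t + \sum_t g t + \sum_t f t * g t.
Proof.
move=> fpm gpm; rewrite -sum1_card natr_sum mulr_sumr.
rewrite -[#|T|]sum1_card natr_sum.
rewrite -!big_split big_mkcond /=; apply: eq_bigr => t _; rewrite inE.
have N1 : ((-1 : R) == 1) = false by apply/eqP; lra.
by case: (fpm t) => ->; case: (gpm t) => ->; rewrite ?eqxx ?N1 /=; lra.
Qed.

Section LinkedSystem.

Variables (R : rcfType) (s N : nat) (M : 'I_N -> 'I_N -> 'M[R]_(s ^ 2)).
Hypothesis hM : linked_hadamard M.

Let entry_tr i j x y : M i j x y = M j i y x.
Proof. by rewrite -(lh_tr hM j i) mxE. Qed.

Lemma linked_hadamard_degree i j x : i != j ->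
  #|[set y | M i j x y == 1]| = (s ^ 2 + s)./2.
Proof.
move=> ij; have := card_sign (fun y => lh_sign hM x y ij).
rewrite (lh_row hM) card_ord -natrD -natrM => /eqP; rewrite eqr_nat => /eqP.
by move=> <-; rewrite mul2n doubleK.
Qed.

(** [i] and [j] may coincide: with [M i i = s I] the same formula counts the
    blocks through two points of a design and the common neighbours in a third
    fiber. *)
Lemma linked_hadamard_common i j h a b : i != h -> j != h ->
  4 * #|[set y | (M i h a y == 1) && (M j h b y == 1)]|%:R =
  (s ^ 2 + 2 * s)%:R + s%:R * M i j a b.
Proof.
move=> ih jh.
rewrite (card_sign2 (fun y => lh_sign hM a y ih) (fun y => lh_sign hM b y jh)).
rewrite !(lh_row hM) card_ord.
have -> : \sum_y M i h a y * M j h b y = s%:R * M i j a b.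
  move/matrixP/(_ a b): (lh_mul hM i h j); rewrite !mxE => <-.
  by apply: eq_bigr => y _; rewrite (entry_tr h j).
by rewrite mul2n -addnn !natrD addrA.
Qed.

Lemma linked_hadamard_two_points i j p q : i != j -> p != q ->
  #|[set b | (M i j p b == 1) && (M i j q b == 1)]| = ((s ^ 2 + 2 * s) %/ 4)%N.
Proof.
move=> ij pq; have := linked_hadamard_common p q ij ij.
rewrite (lh_diag hM) mxE (negPf pq) mulr0 addr0 -natrM => /eqP.
by rewrite eqr_nat => /eqP <-; rewrite mulKn.
Qed.

Lemma linked_hadamard_design i j : i != j ->
  symmetric_design (fun p b => M i j p b == 1)
    (s ^ 2) (s ^ 2 + s)./2 ((s ^ 2 + 2 * s) %/ 4).
Proof.
move=> ij; have ji : j != i by rewrite eq_sym.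
split; rewrite ?card_ord //.
- move=> b; rewrite -(linked_hadamard_degree b ji).
  by apply: eq_card => p; rewrite !inE (entry_tr i j).
- by move=> p; apply: linked_hadamard_degree.
- by move=> p q; apply: linked_hadamard_two_points.
- move=> b c bc; rewrite -(linked_hadamard_two_points ji bc).
  by apply: eq_card => p; rewrite !inE !(entry_tr i j).
Qed.

Definition linked_edge (u v : 'I_N * 'I_(s ^ 2)) : bool :=
  (u.1 != v.1) && (M u.1 v.1 u.2 v.2 == 1).

Definition fiber (i : 'I_N) : {set 'I_N * 'I_(s ^ 2)} := [set v | v.1 == i].

Lemma fiber_imset i : fiber i = [set (i, x) | x : 'I_(s ^ 2)].
Proof.
apply/setP=> -[j x]; rewrite inE /=.
by apply/eqP/imsetP=> [->|[y _ [-> _]] //]; exists x.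
Qed.

Lemma card_fiber i : #|fiber i| = (s ^ 2)%N.
Proof. by rewrite fiber_imset card_imset ?card_ord // => x y []. Qed.

Hypothesis s_gt0 : (0 < s)%N.

Let sqr_gt0 : (0 < s ^ 2)%N. Proof. by rewrite expn_gt0 s_gt0. Qed.
Let x0 : 'I_(s ^ 2) := Ordinal sqr_gt0.

Lemma fiber_inj : injective fiber.
Proof. by move=> i j /setP/(_ (i, x0)); rewrite !inE eqxx => /esym/eqP. Qed.

Lemma fiber_partition : partition [set fiber i | i : 'I_N] [set: _].
Proof.
apply/and3P; split.
- rewrite eqEsubset subsetT; apply/subsetP=> v _.
  by apply/bigcupP; exists (fiber v.1); rewrite ?imset_f // inE.
- apply/trivIsetP=> _ _ /imsetP[i _ ->] /imsetP[j _ ->] neq_ij.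
  apply/pred0P=> v /=; rewrite !inE.
  by apply: contra_neqF neq_ij => /andP[/eqP <- /eqP <-].
- by apply/imsetP=> -[i _ /setP/(_ (i, x0))]; rewrite !inE eqxx.
Qed.

Lemma linked_edge_design i j : i != j ->
  is_design_graph linked_edge (fiber i) (fiber j)
    (s ^ 2) (s ^ 2 + s)./2 ((s ^ 2 + 2 * s) %/ 4).
Proof.
move=> ij; have ji : j != i by rewrite eq_sym.
exists 'I_(s ^ 2), 'I_(s ^ 2), (fun p b => M i j p b == 1).
exists (fun z => match z with inl p => (i, p) | inr b => (j, b) end).
split.
- exact: linked_hadamard_design.
- by move=> [x|x] [y|y] [] => [->|eq_ij|eq_ij|->] //; move: ij;
    rewrite eq_ij eqxx.
- by rewrite fiber_imset.
- by rewrite fiber_imset.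
- move=> [x|x] [y|y]; rewrite /linked_edge /= ?eqxx ?ij ?ji //=.
  by rewrite entry_tr.
Qed.

(** Four times the number of common neighbours is [s ^ 2 + 2 * s] shifted by [s]
    or [- s], according to the sign [M i j a b]. *)
Lemma linked_edge_common h i j a b : h != i -> h != j -> i != j ->
  a \in fiber i -> b \in fiber j ->
  #|[set c in fiber h | linked_edge a c && linked_edge b c]| =
    if linked_edge a b then ((s ^ 2 + 3 * s) %/ 4)%N else ((s ^ 2 + s) %/ 4)%N.
Proof.
rewrite (eq_sym h i) (eq_sym h j); case: a b => [i' a] [j' b] ih jh ij.
rewrite !inE /= => /eqP-> /eqP->; rewrite {3}/linked_edge /= ij /=.
have -> : [set c in fiber h | linked_edge (i, a) c && linked_edge (j, b) c] =
    [set (h, y) | y in [set y | (M i h a y == 1) && (M j h b y == 1)]].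
  apply/setP=> -[h' y]; rewrite !inE /linked_edge /=.
  apply/and3P/imsetP=> [[/eqP-> /andP[_ ay] /andP[_ biy]]|[z + [-> ->]]].
    by exists y; rewrite // inE ay biy.
  by rewrite inE ih jh eqxx => /andP[-> ->].
rewrite card_imset; last by move=> x y [].
have := linked_hadamard_common a b ih jh; set n := #|_|.
have N1 : ((-1 : R) == 1) = false by apply/eqP; lra.
have quarter m : 4 * n%:R = m%:R :> R -> n = (m %/ 4)%N.
  by rewrite -natrM => /eqP; rewrite eqr_nat => /eqP <-; rewrite mulKn.
case: (lh_sign hM a b ij) => -> eq_n; rewrite ?eqxx ?N1; apply: quarter;
  rewrite eq_n !natrD !natrM; ring.
Qed.

Lemma linked_hadamard_LSSD : (2 <= N)%N ->
  LSSD linked_edge [set fiber i | i : 'I_N]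
    (s ^ 2) (s ^ 2 + s)./2 ((s ^ 2 + 2 * s) %/ 4) N.
Proof.
move=> N_ge2; split=> //.
- by rewrite card_prod !card_ord.
- by move=> u v; rewrite /linked_edge eq_sym entry_tr.
- by move=> u; rewrite /linked_edge eqxx.
- exact: fiber_partition.
- by rewrite card_imset ?card_ord //; apply: fiber_inj.
- by move=> _ /imsetP[i _ ->]; apply: card_fiber.
- move=> _ /imsetP[i _ ->] u v; rewrite !inE => /eqP ui /eqP vi.
  by rewrite /linked_edge ui vi eqxx.
- move=> _ _ /imsetP[i _ ->] /imsetP[j _ ->] neq_ij.
  by apply: linked_edge_design; apply: contra_neq neq_ij => ->.
- exists ((s ^ 2 + 3 * s) %/ 4)%N, ((s ^ 2 + s) %/ 4)%N.
  move=> _ _ _ /imsetP[h _ ->] /imsetP[i _ ->] /imsetP[j _ ->] hi hj ij a b.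
  by apply: linked_edge_common; [apply: contra_neq hi | apply: contra_neq hj
    | apply: contra_neq ij] => ->.
Qed.

End LinkedSystem.

Local Close Scope ring_scope.

Theorem theorem8p6 (R : rcfType) (s N : nat) (hs : (1 < s)%N) (hN : (2 <= N)%N)
    (H : 'M[R]_s) (hH : hadamard H) (hreg : regular H)
    (A : 'M['I_s]_(s ^ 2, N)) (hA : orthogonal_array A) :
  (exists S : seq 'M[R]_(s ^ 2),
      size S = (N - 1)%N /\ regular_unbiased_hadamard_set S) /\
  (exists (k lam : nat) (V : finType) (e : rel V) (X : {set {set V}}),
      LSSD e X (s ^ 2) k lam N /\ non_degenerate (s ^ 2) k).
Proof.
have [M hM] := linked_hadamard_exists (ltnW hs) hN hH hreg hA.
split; first exact: linked_hadamard_unbiased hs (ltnW hN) hM.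
do 5!eexists; split; first exact: linked_hadamard_LSSD hM (ltnW hs) hN.
have s_neq2 := regular_hadamard_order_neq2 hH hreg.
rewrite /non_degenerate; nia.
Qed.
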